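(* Let $\mathcal{R} = \langle R, \lesssim\rangle$ be a rulebook on $\mathcal{T}\times\mathcal{E}$ in which every rule $r\in R$ is measurable and is equipped with a risk measure $\rho_r : \mathcal{F}(\Omega,\mathbb{R})\to\mathbb{R}$ and a threshold $\gamma_r\in\mathbb{R}$, and let $\tau^*\in\mathcal{T}$ be an optimal trajectory with respect to the induced risk-aware rulebook $\mathcal{R}_{\text{risk}}$ on $\mathcal{T}$. Suppose that for every $r\in R$ the risk measure $\rho_r$ is monotone, i.e. for all $f,f'\in\mathcal{F}(\Omega,\mathbb{R})$, if $f\le f'$ almost surely then $\rho_r(f)\le\rho_r(f')$. Suppose there exist a trajectory $\tau'\in\mathcal{T}$ and a rule $r'\in R$ with $r'_{\text{risk}}(\tau')<r'_{\text{risk}}(\tau^* )$. Then there exists a rule $r^*\in R$ with $r^*\not< r'$ such that $$\mathit{Pr}\big(\{\omega\in\Omega \mid r^*_{\tau'}(\omega)>r^*_{\tau^*}(\omega)\}\big)>0.$$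
   Context: A preorder $\lesssim$ is a reflexive and transitive binary relation; its strict part is: $a<b$ iff $a\lesssim b$ and not $b\lesssim a$ (also written $b>a$). A rule on a set $\Xi$ is a function $\Xi\to\mathbb{R}_{\ge 0}$. A rulebook on $\Xi$ is a tuple $\langle R,\lesssim\rangle$ where $R$ is a finite set of rules on $\Xi$ and $\lesssim$ is a preorder on $R$; $r'>r$ means $r'$ has higher priority than $r$. Setting: $\mathcal{T}$ (system trajectories) and $\mathcal{E}$ (environment trajectories) are standard Borel spaces; $(\Omega,\Sigma,\mathit{Pr})$ is a probability space with $\Omega$ nonempty and $\Sigma$ standard Borel; $\mathbf{E}:\mathcal{T}\times\Omega\to\mathcal{E}$ is a Borel function, and $\mathbf{E}_\tau(\omega)=\mathbf{E}(\tau,\omega)$. $\mathcal{F}(\Omega,\mathbb{R})$ is the set of measurable functions $\Omega\to\mathbb{R}$. A risk measure is a map $\mathcal{F}(\Omega,\mathbb{R})\to\mathbb{R}$. ''Almost surely'' means outside a set of $\mathit{Pr}$-probability zero. For a measurable rule $r:\mathcal{T}\times\mathcal{E}\to\mathbb{R}_{\ge 0}$ with risk measure $\rho_r$ and threshold $\gamma_r$, and $\tau\in\mathcal{T}$, let $r_\tau:\Omega\to\mathbb{R}_{\ge 0}$, $r_\tau(\omega)=r(\tau,\mathbf{E}_\tau(\omega))$ (a measurable function). The risk-aware rule induced by $(r,\rho_r,\gamma_r)$ is $r_{\text{risk}}:\mathcal{T}\to\mathbb{R}_{\ge 0}$, $r_{\text{risk}}(\tau)=\max\{\rho_r(r_\tau)-\gamma_r,0\}$.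 The induced risk-aware rulebook is $\mathcal{R}_{\text{risk}}=\langle R_{\text{risk}},\lesssim_{\text{risk}}\rangle$ with $R_{\text{risk}}=\{r_{\text{risk}} \mid r\in R\}$ and $r_{\text{risk}}\lesssim_{\text{risk}} r'_{\text{risk}}$ if and only if $r\lesssim r'$. Here the elements of $R_{\text{risk}}$ are regarded as indexed by $R$ (distinct rules give distinct elements even if the functions coincide). For $\tau,\tau'\in\mathcal{T}$: $\tau\lesssim_{\mathcal{R}_{\text{risk}}}\tau'$ iff for every $r_{\text{risk}}\in R_{\text{risk}}$ with $r_{\text{risk}}(\tau)>r_{\text{risk}}(\tau')$ there exists $r'_{\text{risk}}>_{\text{risk}} r_{\text{risk}}$ with $r'_{\text{risk}}(\tau')>r'_{\text{risk}}(\tau)$. And $\tau<_{\mathcal{R}_{\text{risk}}}\tau'$ iff $\tau\lesssim_{\mathcal{R}_{\text{risk}}}\tau'$ but not $\tau'\lesssim_{\mathcal{R}_{\text{risk}}}\tau$. A trajectory $\tau^*\in\mathcal{T}$ is optimal if there is no $\tau\in\mathcal{T}$ with $\tau<_{\mathcal{R}_{\text{risk}}}\tau^*$. *)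

(* Defs.v *)
From HB Require Import structures.
From mathcomp Require Import all_boot all_order all_algebra.
From mathcomp Require Import all_classical all_reals all_analysis.
Set Implicit Arguments.
Unset Strict Implicit.
Unset Printing Implicit Defensive.
Import Order.TTheory GRing.Theory Num.Theory.
Import numFieldNormedType.Exports.
Local Open Scope classical_set_scope.
Local Open Scope ring_scope.

(* [X] carries a complete pseudometric, which is a metric once [X] is
   Hausdorff. *)
Definition polish (R : realType) (X : completePseudoMetricType R) : Prop :=
  hausdorff_space X /\ exists2 D : set X, countable D & dense D.

(* [T] is isomorphic, as a measurable space, to a Polish space with its Borel
   sigma-algebra; the library's complete spaces are pointed, so [T] is
   nonempty. *)
Definition standard_borel (R : realType) d (T : measurableType d) : Prop :=
  exists (X : completePseudoMetricType R) (f : T -> X),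
    [/\ polish X, bijective f &
        forall A : set T, measurable A <-> <<s @open X >> (f @` A)].

(* The rules are indexed by a finite preordered type of labels, [r < r']
   meaning that [r'] has the higher priority; [rule] need not be injective,
   since distinct rules may induce equal risk-aware rules. A set of rules is
   the case where [rule] is injective. *)
Record rulebook (R : realType) (Xi : Type) := Rulebook {
  rb_disp : Order.disp_t;
  label : finPreorderType rb_disp;
  rule : label -> Xi -> R;
  rule_ge0 : forall r x, 0 <= rule r x
}.
Arguments label {R Xi} _.
Arguments rule {R Xi} _ _ _.

Definition rb_le (R : realType) (Xi : Type) (B : rulebook R Xi) (x y : Xi) :
    Prop :=
  forall r : label B, rule B r y < rule B r x ->
    exists2 r' : label B, (r < r')%O & rule B r' x < rule B r' y.

Definition rb_lt (R : realType) (Xi : Type) (B : rulebook R Xi) (x y : Xi) :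
    Prop :=
  rb_le B x y /\ ~ rb_le B y x.

Definition rb_optimal (R : realType) (Xi : Type) (B : rulebook R Xi)
    (x : Xi) : Prop :=
  ~ exists y : Xi, rb_lt B y x.

Definition risk_measure (R : realType) d (Omega : measurableType d) : Type :=
  {mfun Omega >-> R} -> R.

Definition monotone_risk (R : realType) d (Omega : measurableType d)
    (P : probability Omega R) (rho : risk_measure R Omega) : Prop :=
  forall f g : {mfun Omega >-> R},
    {ae P, forall w, f w <= g w} -> rho f <= rho g.

Section Risk.
Context (R : realType) (dT dE dO : measure_display).
Context (T : measurableType dT) (E : measurableType dE).
Context (Omega : measurableType dO) (EE : {mfun (T * Omega)%type >-> E}).

(* [realize r tau w] is r_tau(w) = r(tau, E_tau(w)), with the Borel map [EE]
   sending (tau, w) to the environment trajectory E_tau(w). *)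
Definition realize (r : T * E -> R) (tau : T) (w : Omega) : R :=
  r (tau, EE (tau, w)).

Lemma measurable_realize (r : T * E -> R) (tau : T) :
  measurable_fun [set: T * E] r -> measurable_fun [set: Omega] (realize r tau).
Proof.
move=> mr; apply: (measurableT_comp mr).
apply: measurable_fun_pair; first exact: measurable_cst.
by apply: measurableT_comp => //; exact: pair1_measurable.
Qed.

Definition realize_mfun (r : T * E -> R) (mr : measurable_fun [set: T * E] r)
    (tau : T) : {mfun Omega >-> R} :=
  mfun_Sub (mem_set (measurable_realize tau mr)).

Definition risk_rule (r : T * E -> R) (mr : measurable_fun [set: T * E] r)
    (rho : risk_measure R Omega) (gamma : R) (tau : T) : R :=
  Num.max (rho (realize_mfun mr tau) - gamma) 0.

Lemma risk_rule_ge0 (r : T * E -> R) (mr : measurable_fun [set: T * E] r)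
    (rho : risk_measure R Omega) (gamma : R) (tau : T) :
  0 <= risk_rule mr rho gamma tau.
Proof. by rewrite /risk_rule le_max lexx orbT. Qed.

(* Same labels and same priorities as [B]: one risk-aware rule per rule of
   [B], even if the resulting functions coincide. *)
Definition risk_rulebook (B : rulebook R (T * E))
    (mB : forall r : label B, measurable_fun [set: T * E] (rule B r))
    (rho : label B -> risk_measure R Omega) (gamma : label B -> R) :
    rulebook R T :=
  {| label := label B;
     rule := fun r : label B => risk_rule (mB r) (rho r) (gamma r);
     rule_ge0 := fun r : label B => risk_rule_ge0 (mB r) (rho r) (gamma r) |}.
End Risk.

(* Main.v *)
Require Import Defs.
From HB Require Import structures.
From mathcomp Require Import all_boot all_order all_algebra.
From mathcomp Require Import all_classical all_reals all_analysis.
From mathcomp Require Import measurable_realfun.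
Set Implicit Arguments.
Unset Strict Implicit.
Unset Printing Implicit Defensive.
Import Order.TTheory GRing.Theory Num.Theory.
Import numFieldNormedType.Exports.
Local Open Scope classical_set_scope.
Local Open Scope ring_scope.

(** At an optimal point, a gain in [r'] must be paid for by a loss in some rule not below [r']; this
    is pure order theory ([optimal_tradeoff]). Subtracting the threshold and truncating at 0 is
    nondecreasing, so the loss comes from a strictly larger risk at [tau'], which a monotone risk
    measure allows only if the realized violation grows with positive probability
    ([monotone_risk_lt]). *)

(* If every rule that is worse at [y] were below [r], then [r] would compensate
   all of them, while nothing above [r] could compensate [r] itself: [y] would
   be strictly preferred to [x]. *)
Lemma optimal_tradeoff (R : realType) (Xi : Type) (B : rulebook R Xi)
    (x y : Xi) (r : label B) :
  rb_optimal B x -> rule B r y < rule B r x ->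
  exists2 s : label B, ~ (s < r)%O & rule B s x < rule B s y.
Proof.
move=> opt better; apply: contrapT => noworse.
have worse_lt s : rule B s x < rule B s y -> (s < r)%O.
  by move=> worse; apply: contrapT => nlt; apply: noworse; exists s.
apply: opt; exists y; split; first by move=> s /worse_lt ?; exists r.
by move=> /(_ r better)[s rs /worse_lt /(lt_trans rs)]; rewrite ltxx.
Qed.

(** Contrapositive of monotonicity: if [f < g] held only on a null set, then [g <= f] almost surely,
    hence [rho g <= rho f]. *)
Lemma monotone_risk_lt (R : realType) d (Omega : measurableType d)
    (P : probability Omega R) (rho : risk_measure R Omega)
    (f g : {mfun Omega >-> R}) :
  monotone_risk P rho -> rho f < rho g -> (0 < P [set w | f w < g w]%R)%E.
Proof.
move=> mono rho_fg; rewrite lt0e measure_ge0 andbT.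
apply/eqP => Pfg0; move: rho_fg; rewrite ltNge => /negP; apply; apply: mono.
(* The exceptional set is the strict set itself, measurable as the preimage of [true] under the
   comparison. *)
exists [set w | f w < g w]; split=> //.
  have mlt : measurable_fun setT (fun w => f w < g w).
    by apply: measurable_fun_ltr; exact: measurable_funPT.
  by have := mlt measurableT [set true] I; rewrite setTI.
by move=> w /= /negP; rewrite -ltNge.
Qed.

Theorem proposition3 (R : realType) (dT dE dO : measure_display)
  (T : measurableType dT) (E : measurableType dE) (Omega : measurableType dO)
  (T_std : standard_borel R T) (E_std : standard_borel R E)
  (Omega_neq0 : [set: Omega] !=set0) (Omega_std : standard_borel R Omega)
  (P : probability Omega R)
  (EE : {mfun (T * Omega)%type >-> E})
  (B : rulebook R (T * E)) (B_set : injective (rule B))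
  (mB : forall r : label B, measurable_fun [set: T * E] (rule B r))
  (rho : label B -> risk_measure R Omega) (gamma : label B -> R)
  (tau_star : T)
  (opt : rb_optimal (risk_rulebook EE mB rho gamma) tau_star)
  (mono : forall r : label B, monotone_risk P (rho r))
  (tau' : T) (r' : label B)
  (better : risk_rule EE (mB r') (rho r') (gamma r') tau'
            < risk_rule EE (mB r') (rho r') (gamma r') tau_star) :
  exists r_star : label B, ~ (r_star < r')%O /\
    (0 < P [set w | realize EE (rule B r_star) tau_star w
                    < realize EE (rule B r_star) tau' w]%R)%E.
Proof.
have [s nlt worse] := optimal_tradeoff opt better.
exists s; split=> //.
apply: (monotone_risk_lt (f := realize_mfun EE (mB s) tau_star)
  (g := realize_mfun EE (mB s) tau') (mono s)).
(* If the risk did not increase, neither would its shifted and truncated value, against [worse]. *)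
rewrite ltNge; apply/negP => le_rho; move: worse.
by rewrite ltNge => /negP; apply; apply: le_max2; rewrite ?lerB.
Qed.
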